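(* Let $D_1$ be a first-derivative SBP operator on a grid with $N$ nodes with diagonal mass matrix $M$, and let $P_D=\operatorname{diag}(0,1,\dots,1,0)$. Let $g>0$, let $\boldsymbol b\in\mathbb R^N$ be the bathymetry vector (constant in time), and let $\boldsymbol{\hat\beta}=\tilde\beta\boldsymbol D^3$ be the coefficient vector given in the context. Consider the semidiscretization for $\boldsymbol h(t),\boldsymbol v(t)\in\mathbb R^N$ with $\boldsymbol h>0$ componentwise: $$\boldsymbol h_t=-D_1(\boldsymbol h\boldsymbol v),$$ $$(\boldsymbol h\boldsymbol v)_t=-\tfrac12\big(D_1(\boldsymbol h\boldsymbol v^2)+\boldsymbol h\boldsymbol vD_1\boldsymbol v+\boldsymbol vD_1(\boldsymbol h\boldsymbol v)\big)-g\boldsymbol hD_1(\boldsymbol h+\boldsymbol b)+P_DD_1(\boldsymbol{\hat\beta}D_1\boldsymbol v_t),$$ where the Dirichlet boundary conditions are imposed strongly by explicitly setting $v_1=v_N=0$ for all times (so that the second equation is imposed at the interior nodes $2,\dots,N-1$ and is replaced by $v_1=v_N=0$ at the two boundary nodes). Then, along every solution, the total mass $\mathcal M(t)=\boldsymbol 1^TM\boldsymbol h$ is conserved and the total modified entropy $$\hat{\mathcal E}(t)=\boldsymbol 1^TM\Big(\tfrac12(\boldsymbol h\boldsymbol v^2+g\boldsymbol h^2)+g\boldsymbol h\boldsymbol b+\tfrac12\boldsymbol{\hat\beta}(D_1\boldsymbol v)^2\Big)$$ is conserved. Moreover, the scheme is well-balanced: every lake-at-rest state $\boldsymbol v=\boldsymbol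 0$, $\boldsymbol h+\boldsymbol b=c\,\boldsymbol 1$ with $c\in\mathbb R$ (and $\boldsymbol h>0$) is a stationary solution.
   Context: Products and powers of vectors in $\mathbb R^N$ are taken componentwise: $(\boldsymbol u\boldsymbol v)_j=u_jv_j$, $(\boldsymbol u^k)_j=u_j^k$; expressions such as $\boldsymbol vD_1(\boldsymbol h\boldsymbol v)$ mean the componentwise product of $\boldsymbol v$ and $D_1(\boldsymbol h\boldsymbol v)$. $\boldsymbol 1=(1,\dots,1)^T$, $\boldsymbol 0=(0,\dots,0)^T$, $\boldsymbol e_L=(1,0,\dots,0)^T$, $\boldsymbol e_R=(0,\dots,0,1)^T$. ''Conserved'' means that the time derivative vanishes along every (continuously differentiable in time) solution. A derivative matrix $A\in\mathbb R^{N\times N}$ is consistent if $A\boldsymbol 1=\boldsymbol 0$. A first-derivative SBP (summation-by-parts) operator consists of a grid $\boldsymbol x$, a consistent first-derivative matrix $D_1$ and a symmetric positive-definite matrix $M$ such that $MD_1+D_1^TM=\boldsymbol e_R\boldsymbol e_R^T-\boldsymbol e_L\boldsymbol e_L^T$. Throughout, $M$ is diagonal. Coefficients: with still water depth $\boldsymbol D=\eta_0\boldsymbol 1-\boldsymbol b$ (componentwise positive) for a reference height $\eta_0$ and a parameter $\tilde\beta\in\mathbb R$, $\boldsymbol{\hat\beta}=\tilde\beta\boldsymbol D^3$ componentwise (constant in time). The system is a semidiscretization of the dispersive shallow water model of Svärd and Kalisch in the case $\tilde\alpha=\tilde\gamma=0$ with reflecting boundary conditions $v=0$ at both ends of the domain;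 $h$ is the water height, $v$ the velocity, $b$ the bathymetry. *)

(* Defs.v *)
From HB Require Import structures.
From mathcomp Require Import all_boot all_order all_algebra.
From mathcomp Require Import all_classical all_reals all_analysis.

Set Implicit Arguments.
Unset Strict Implicit.
Unset Printing Implicit Defensive.

Import Order.TTheory GRing.Theory Num.Theory.
Import numFieldNormedType.Exports.

Local Open Scope classical_set_scope.
Local Open Scope ring_scope.

Definition cmul (R : realType) (n : nat) (u v : 'cV[R]_n) : 'cV[R]_n :=
  map2_mx *%R u v.

Definition cexp (R : realType) (n : nat) (u : 'cV[R]_n) (k : nat) : 'cV[R]_n :=
  map_mx (fun a => a ^+ k) u.

Notation "u ⊙ v" := (cmul u v) (at level 40, left associativity) : ring_scope.
Notation "u ^⊙ k" := (cexp u k%N) (at level 29, left associativity) : ring_scope.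

Definition cpos (R : realType) (n : nat) (u : 'cV[R]_n) : Prop :=
  forall i, 0 < u i 0.

Definition ones (R : realType) (n : nat) : 'cV[R]_n := const_mx 1.

Definition consistent (R : realType) (n : nat) (A : 'M[R]_n) : Prop :=
  A *m ones R n = 0.

Definition spd (R : realType) (n : nat) (M : 'M[R]_n) : Prop :=
  M^T = M /\ forall x : 'cV[R]_n, x != 0 -> 0 < (x^T *m M *m x) 0 0.

(* The number of nodes is N = n.+1, so that the first node [ord0] and the last
   node [ord_max] exist. *)
Definition eL (R : realType) (n : nat) : 'cV[R]_n.+1 := delta_mx ord0 0.
Definition eR (R : realType) (n : nat) : 'cV[R]_n.+1 := delta_mx ord_max 0.

(* No ordering of the nodes is required: grids with repeated nodes (as in
   discontinuous element-type operators) are allowed. *)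
Record sbp_operator (R : realType) (n : nat) := SBPOperator {
  sbp_grid : 'cV[R]_n.+1;
  sbp_D1 : 'M[R]_n.+1;
  sbp_M : 'M[R]_n.+1;
  sbp_consistent : consistent sbp_D1;
  sbp_spd : spd sbp_M;
  sbp_by_parts :
    sbp_M *m sbp_D1 + sbp_D1^T *m sbp_M =
    eR R n *m (eR R n)^T - eL R n *m (eL R n)^T }.

Definition P_D (R : realType) (n : nat) : 'M[R]_n.+1 :=
  diag_mx (\row_i ((i != ord0) && (i != ord_max))%:R).

Definition still_depth (R : realType) (n : nat) (eta0 : R) (b : 'cV[R]_n) :
  'cV[R]_n := eta0 *: ones R n - b.

Definition beta_hat (R : realType) (n : nat) (betat eta0 : R) (b : 'cV[R]_n) :
  'cV[R]_n := betat *: (still_depth eta0 b ^⊙ 3).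

Definition momentum_rhs (R : realType) (n : nat) (D1 : 'M[R]_n.+1) (g : R)
    (b beta h v vt : 'cV[R]_n.+1) : 'cV[R]_n.+1 :=
  - (2^-1 *: (D1 *m (h ⊙ v ^⊙ 2) + h ⊙ v ⊙ (D1 *m v) + v ⊙ (D1 *m (h ⊙ v))))
  - g *: (h ⊙ (D1 *m (h + b)))
  + P_D R n *m (D1 *m (beta ⊙ (D1 *m vt))).

(* [J] is the time interval. Only the values on [J] matter; at an endpoint
   belonging to [J] the two-sided derivative is no restriction, since a
   function that is C^1 up to the endpoint (one-sided derivative) can be
   extended affinely beyond it. *)
Definition C1_on (R : realType) (n : nat) (J : set R) (f : R -> 'cV[R]_n.+1) :
  Prop :=
  (forall t, J t -> derivable f t 1) /\ {within J, continuous (derive1 f)}.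

(* The momentum equation is imposed at the interior nodes only; at the two
   boundary nodes it is replaced by the Dirichlet conditions. *)
Definition is_solution (R : realType) (n : nat) (D1 : 'M[R]_n.+1) (g : R)
    (b beta : 'cV[R]_n.+1) (J : set R) (h v : R -> 'cV[R]_n.+1) : Prop :=
  [/\ C1_on J h, C1_on J v, (forall t, J t -> cpos (h t)) &
      forall t, J t ->
        [/\ derive1 h t = - (D1 *m (h t ⊙ v t)),
            (forall i : 'I_n.+1, i != ord0 -> i != ord_max ->
               (derive1 (fun s => h s ⊙ v s) t) i 0 =
               (momentum_rhs D1 g b beta (h t) (v t) (derive1 v t)) i 0),
            (v t) ord0 0 = 0 &
            (v t) ord_max 0 = 0] ].

Definition stationary_solution (R : realType) (n : nat) (D1 : 'M[R]_n.+1)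
    (g : R) (b beta h v : 'cV[R]_n.+1) : Prop :=
  is_solution D1 g b beta setT (cst h) (cst v).

Definition discrete_integral (R : realType) (n : nat) (M : 'M[R]_n) (u : 'cV[R]_n) : R :=
  ((ones R n)^T *m M *m u) 0 0.

Definition modified_entropy (R : realType) (n : nat) (D1 : 'M[R]_n.+1) (g : R)
    (b beta h v : 'cV[R]_n.+1) : 'cV[R]_n.+1 :=
  2^-1 *: (h ⊙ v ^⊙ 2 + g *: h ^⊙ 2) + g *: (h ⊙ b)
  + 2^-1 *: (beta ⊙ (D1 *m v) ^⊙ 2).

Definition conserved_on (R : realType) (J : set R) (F : R -> R) : Prop :=
  forall t, J t -> is_derive t 1 F 0.

(* Main.v *)
(** For a diagonal mass matrix the SBP property reads, for the quadrature
    [I u = 1^T M u],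
      [I (u ⊙ D1 w + w ⊙ D1 u) = u_N w_N - u_1 w_1],
    which vanishes as soon as [u] vanishes at both ends.  With [q = h ⊙ v], the
    time derivative of the entropy is minus the quadrature of
      [(1/2) (v ⊙ D1 (q ⊙ v) + (q ⊙ v) ⊙ D1 v)
       + g (q ⊙ D1 (h + b) + (h + b) ⊙ D1 q)
       - (v ⊙ D1 (beta ⊙ D1 v_t) + (beta ⊙ D1 v_t) ⊙ D1 v)],
    three terms of that form with [u = v], [u = q] and [u = v]; multiplying the
    momentum equation by [v] makes its boundary rows, and hence [P_D],
    irrelevant. *)
Require Import Defs.
From HB Require Import structures.
From mathcomp Require Import all_boot all_order all_algebra.
From mathcomp Require Import all_classical all_reals all_analysis.
From mathcomp Require Import lra.

Set Implicit Arguments.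
Unset Strict Implicit.
Unset Printing Implicit Defensive.

Import Order.TTheory GRing.Theory Num.Theory.
Import numFieldNormedType.Exports.

Local Open Scope classical_set_scope.
Local Open Scope ring_scope.

Section MatrixDerivatives.
Variables (R : realType) (V : normedModType R) (t e : V).

(** Reduces the calculus of matrix-valued functions to the scalar rules. *)
Lemma is_derive_mxP (m n : nat) (f : V -> 'M[R]_(m, n)) (df : 'M[R]_(m, n)) :
  is_derive t e f df <->
  forall i j, is_derive t e (fun s => f s i j) (df i j).
Proof.
split=> [[fd <-] i j|fd].
  rewrite derive_mx// mxE; apply: derivableP.
  by move/derivable_mxP : fd.
have dfd : derivable f t e by apply/derivable_mxP => i j; case: (fd i j).
by split=> //; rewrite derive_mx//; apply/matrixP => i j; rewrite mxE derive_val.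
Qed.

Lemma is_derive_mulmxl (m n p : nat) (A : 'M[R]_(m, n))
    (f : V -> 'M[R]_(n, p)) (df : 'M[R]_(n, p)) :
  is_derive t e f df -> is_derive t e (fun s => A *m f s) (A *m df).
Proof.
move=> /is_derive_mxP fd; apply/is_derive_mxP => i j.
rewrite mxE (_ : (fun _ => _) = \sum_k (A i k \*: (fun s => f s k j))).
  exact: is_derive_sum.
by apply/funext => s; rewrite mxE fct_sumE.
Qed.

Lemma is_derive_cmul (n : nat) (f g : V -> 'cV[R]_n) (df dg : 'cV[R]_n) :
  is_derive t e f df -> is_derive t e g dg ->
  is_derive t e (fun s => f s ⊙ g s) (df ⊙ g t + f t ⊙ dg).
Proof.
move=> /is_derive_mxP fd /is_derive_mxP gd; apply/is_derive_mxP => i j.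
rewrite (_ : (fun _ => _) = (fun s => f s i j) * (fun s => g s i j)).
  by apply: is_derive_eq; rewrite !mxE addrC; congr (_ + _); exact: mulrC.
by apply/funext => s; rewrite !mxE.
Qed.

Lemma is_derive_discrete_integral (n : nat) (M : 'M[R]_n) (f : V -> 'cV[R]_n)
    (df : 'cV[R]_n) :
  is_derive t e f df ->
  is_derive t e (fun s => discrete_integral M (f s)) (discrete_integral M df).
Proof.
move=> fd.
by have /is_derive_mxP := is_derive_mulmxl ((ones R n)^T *m M) fd; apply.
Qed.

End MatrixDerivatives.

Lemma is_derive_derive1 (R : realType) (W : normedModType R) (f : R -> W)
    (t : R) :
  derivable f t 1 -> is_derive t 1 f (derive1 f t).
Proof. by rewrite derive1E => /derivableP. Qed.

Lemma cexp2 (R : realType) (n : nat) (u : 'cV[R]_n) : u ^⊙ 2 = u ⊙ u.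
Proof. by apply/matrixP => i j; rewrite !mxE expr2. Qed.

Lemma cmulr0 (R : realType) (n : nat) (u : 'cV[R]_n) : u ⊙ 0 = 0.
Proof. by apply/matrixP => i j; rewrite !mxE mulr0. Qed.

Lemma cmul0r (R : realType) (n : nat) (u : 'cV[R]_n) : 0 ⊙ u = 0.
Proof. by apply/matrixP => i j; rewrite !mxE mul0r. Qed.

Section DiscreteIntegral.
Variables (R : realType) (n : nat) (M : 'M[R]_n).

Lemma discrete_integralD (u w : 'cV[R]_n) :
  discrete_integral M (u + w) = discrete_integral M u + discrete_integral M w.
Proof. by rewrite /discrete_integral mulmxDr mxE. Qed.

Lemma discrete_integralZ (a : R) (u : 'cV[R]_n) :
  discrete_integral M (a *: u) = a * discrete_integral M u.
Proof. by rewrite /discrete_integral -scalemxAr mxE. Qed.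

(** Turns quadratures of products into bilinear forms, to which the SBP identity applies; this is
    where diagonality of [M] enters. *)
Lemma discrete_integral_cmul (u w : 'cV[R]_n) :
  is_diag_mx M -> discrete_integral M (u ⊙ w) = (u^T *m M *m w) 0 0.
Proof.
move=> /diag_mxP [d ->].
rewrite /discrete_integral !mul_mx_diag !mxE; apply: eq_bigr => i _.
by rewrite !mxE mul1r mulrCA mulrA.
Qed.

End DiscreteIntegral.

Section SummationByParts.
Variables (R : realType) (n : nat) (op : sbp_operator R n).
Hypothesis M_diag : is_diag_mx (sbp_M op).
Local Notation D1 := (sbp_D1 op).
Local Notation I := (discrete_integral (sbp_M op)).

Lemma sbp_M_tr : (sbp_M op)^T = sbp_M op.
Proof. by case: (sbp_spd op). Qed.

Lemma summation_by_parts (u w : 'cV[R]_n.+1) :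
  I (u ⊙ (D1 *m w) + w ⊙ (D1 *m u)) =
  u ord_max 0 * w ord_max 0 - u ord0 0 * w ord0 0.
Proof.
rewrite discrete_integralD !discrete_integral_cmul//.
have -> : (w^T *m sbp_M op *m (D1 *m u)) 0 0 =
          (u^T *m (D1^T *m sbp_M op) *m w) 0 0.
  (* A 1 by 1 matrix equals its transpose, and [M] is symmetric. *)
  rewrite -[w^T *m _ *m _]trmxK [LHS]mxE.
  by rewrite !trmx_mul trmxK sbp_M_tr !mulmxA.
have -> : u^T *m sbp_M op *m (D1 *m w) = u^T *m (sbp_M op *m D1) *m w.
  by rewrite !mulmxA.
transitivity ((u^T *m (sbp_M op *m D1 + D1^T *m sbp_M op) *m w) 0 0).
  by rewrite mulmxDr mulmxDl [RHS]mxE.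
rewrite sbp_by_parts mulmxBr mulmxBl !mulmxA /eR /eL !trmx_delta -!colE.
by rewrite -!mulmxA -!rowE !mxE !big_ord1 !mxE.
Qed.

Lemma summation_by_parts0 (u w : 'cV[R]_n.+1) :
  u ord0 0 = 0 -> u ord_max 0 = 0 -> I (u ⊙ (D1 *m w) + w ⊙ (D1 *m u)) = 0.
Proof. by move=> u0 uN; rewrite summation_by_parts u0 uN !mul0r subrr. Qed.

(** Summation by parts against [ones], whose discrete derivative vanishes by consistency. *)
Lemma mass_rate0 (q : 'cV[R]_n.+1) :
  q ord0 0 = 0 -> q ord_max 0 = 0 -> I (- (D1 *m q)) = 0.
Proof.
move=> q0 qN; rewrite -scaleN1r discrete_integralZ.
rewrite -[X in I X](_ : q ⊙ (D1 *m ones R n.+1) + ones R n.+1 ⊙ (D1 *m q) = _).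
  by rewrite summation_by_parts0// mulr0.
rewrite (sbp_consistent op).
by apply/matrixP => i j; rewrite !mxE mulr0 mul1r add0r.
Qed.

(** Here [w] stands for the time derivative of [h ⊙ v]. At the end nodes both sides vanish with [v];
    at the others [P_D] acts as the identity. *)
Lemma momentum_work (g : R) (b beta h v vt w : 'cV[R]_n.+1) :
  (forall i : 'I_n.+1, i != ord0 -> i != ord_max ->
     w i 0 = momentum_rhs D1 g b beta h v vt i 0) ->
  v ord0 0 = 0 -> v ord_max 0 = 0 ->
  v ⊙ w = v ⊙ (- (2^-1 *: (D1 *m (h ⊙ v ^⊙ 2) + h ⊙ v ⊙ (D1 *m v)
                          + v ⊙ (D1 *m (h ⊙ v))))
               - g *: (h ⊙ (D1 *m (h + b))) + D1 *m (beta ⊙ (D1 *m vt))).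
Proof.
move=> w_int v0 vN; apply/matrixP => i j; rewrite ord1 mxE [RHS]mxE.
have [->|i0] := eqVneq i ord0; first by rewrite v0 !mul0r.
have [->|iN] := eqVneq i ord_max; first by rewrite vN !mul0r.
rewrite w_int// /momentum_rhs /P_D mul_diag_mx; congr (_ * _).
by rewrite [LHS]mxE [RHS]mxE; congr (_ + _); rewrite !mxE i0 iN mul1r.
Qed.

(** A purely algebraic statement at one instant: the integrand is the entropy rate in the shape that
    the product rule produces. *)
Lemma entropy_rate0 (g : R) (b beta h v ht vt : 'cV[R]_n.+1) :
  ht = - (D1 *m (h ⊙ v)) ->
  (forall i : 'I_n.+1, i != ord0 -> i != ord_max ->
     (ht ⊙ v + h ⊙ vt) i 0 = momentum_rhs D1 g b beta h v vt i 0) ->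
  v ord0 0 = 0 -> v ord_max 0 = 0 ->
  I (2^-1 *: (ht ⊙ (v ⊙ v) + h ⊙ (vt ⊙ v + v ⊙ vt)
              + g *: (ht ⊙ h + h ⊙ ht))
     + g *: (ht ⊙ b)
     + 2^-1 *: (beta ⊙ ((D1 *m vt) ⊙ (D1 *m v) + (D1 *m v) ⊙ (D1 *m vt)))) = 0.
Proof.
move=> htE hvt v0 vN.
have work := momentum_work hvt v0 vN.
set q := h ⊙ v in htE work.
have q0 : q ord0 0 = 0 by rewrite mxE v0 mulr0.
have qN : q ord_max 0 = 0 by rewrite mxE vN mulr0.
set k := beta ⊙ (D1 *m vt) in work.
set X := (X in I X).
(* The kinetic rate is [v ⊙ w - 2^-1 *: (ht ⊙ v ^⊙ 2)] with [w = ht ⊙ v + h ⊙ vt]. Since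
   [ht = - (D1 *m q)], its second term cancels the contribution of [v ⊙ (D1 *m q)] in the split
   form. *)
have -> : X = - 2^-1 *: (v ⊙ (D1 *m (q ⊙ v)) + (q ⊙ v) ⊙ (D1 *m v))
            + - g *: (q ⊙ (D1 *m (h + b)) + (h + b) ⊙ (D1 *m q))
            + (v ⊙ (D1 *m k) + k ⊙ (D1 *m v)).
  have hvv : h ⊙ v ^⊙ 2 = q ⊙ v.
    by rewrite cexp2; apply/matrixP => i j; rewrite !mxE mulrA.
  rewrite hvv in work; rewrite /X.
  (* With all discrete derivatives made arbitrary vectors, the claim is entrywise and follows
     linearly from [work], monomials being atoms. *)
  move: (D1 *m (q ⊙ v)) (D1 *m (h + b)) (D1 *m k) work => a e f.
  rewrite /k /q htE; move: (D1 *m v) (D1 *m vt) (D1 *m (h ⊙ v)) => c r d work.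
  apply/matrixP => i j; move/matrixP : work => /(_ i j).
  rewrite !mxE; move: (h i j) (v i j) (vt i j) => hi vi vti work.
  lra.
(* The unscaled third pair gets split with the outer sum; the reversed rewrite joins it again. *)
by rewrite !discrete_integralD !discrete_integralZ -!discrete_integralD
  !summation_by_parts0// !mulr0 !addr0.
Qed.

End SummationByParts.

(** The gravity term is the only one without a factor [v] or [vt]; consistency annihilates it
    because [h + b] is constant. *)
Lemma lake_at_rest_stationary (R : realType) (n : nat) (D1 : 'M[R]_n.+1)
    (g c : R) (b beta h : 'cV[R]_n.+1) :
  consistent D1 -> h + b = c *: ones R n.+1 -> cpos h ->
  stationary_solution D1 g b beta h 0.
Proof.
move=> D1_1 hb h_gt0.
have cst_C1 (u : 'cV[R]_n.+1) : C1_on setT (cst u).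
  split=> [t _|]; first exact: derivable_cst.
  rewrite (_ : derive1 _ = cst 0); last by apply/funext => t; exact: derive1_cst.
  exact/continuous_subspaceT/cst_continuous.
split=> //; do ?exact: cst_C1.
move=> t _; rewrite /= !derive1_cst.
split=> [|i _ _||].
- by rewrite cmulr0 mulmx0 oppr0.
- rewrite /momentum_rhs hb -scalemxAr D1_1 cexp2.
  by rewrite !(cmulr0, mulmx0, scaler0, addr0, subr0, oppr0).
- by rewrite mxE.
- by rewrite mxE.
Qed.

Theorem theorem3p13 (R : realType) (n : nat) (op : sbp_operator R n)
    (M_diag : is_diag_mx (sbp_M op))
    (g : R) (g_gt0 : 0 < g)
    (b : 'cV[R]_n.+1) (eta0 betat : R)
    (D_gt0 : cpos (still_depth eta0 b)) :
  (forall (J : set R) (h v : R -> 'cV[R]_n.+1),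
     is_interval J ->
     is_solution (sbp_D1 op) g b (beta_hat betat eta0 b) J h v ->
     conserved_on J (fun t => discrete_integral (sbp_M op) (h t)) /\
     conserved_on J (fun t => discrete_integral (sbp_M op)
       (modified_entropy (sbp_D1 op) g b (beta_hat betat eta0 b) (h t) (v t))))
  /\
  (forall (c : R) (h v : 'cV[R]_n.+1),
     v = 0 -> h + b = c *: ones R n.+1 -> cpos h ->
     stationary_solution (sbp_D1 op) g b (beta_hat betat eta0 b) h v).
Proof.
split=> [J h v _ [[hd _] [vd _] _ sol]|c h v -> hb h_gt0]; last first.
  exact: lake_at_rest_stationary (sbp_consistent op) hb h_gt0.
split=> t Jt; have [htE hvt v0 vN] := sol t Jt;
  have ht := is_derive_derive1 (hd t Jt).
  (* The claimed derivative 0 is rewritten as the quadrature of the time derivative of [h]. *)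
  rewrite -(mass_rate0 M_diag (q := h t ⊙ v t)) -?htE.
  - exact: is_derive_discrete_integral.
  - by rewrite mxE v0 mulr0.
  - by rewrite mxE vN mulr0.
have vt := is_derive_derive1 (vd t Jt).
have hvtE : derive1 (fun s => h s ⊙ v s) t
            = derive1 h t ⊙ v t + h t ⊙ derive1 v t.
  by rewrite derive1E; have [] := is_derive_cmul ht vt.
rewrite hvtE in hvt.
rewrite -(entropy_rate0 M_diag htE hvt v0 vN).
apply: is_derive_discrete_integral; rewrite /modified_entropy.
under eq_fun do rewrite !cexp2.
have D1v := is_derive_mulmxl (sbp_D1 op) vt.
have cstd (u : 'cV[R]_n.+1) := is_derive_cst u t (1 : R).
have kin := is_derive_cmul ht (is_derive_cmul vt vt).
have grav := is_deriveZ g (is_derive_cmul ht ht).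
have bath := is_deriveZ g (is_derive_cmul ht (cstd b)).
have disp := is_derive_cmul (cstd (beta_hat betat eta0 b))
                            (is_derive_cmul D1v D1v).
have := is_deriveD
  (is_deriveD (is_deriveZ 2^-1 (is_deriveD kin grav)) bath)
  (is_deriveZ 2^-1 disp).
(* Only the zero terms from the constant [b] and [beta_hat] separate the product rule from the form
   in [entropy_rate0]. *)
rewrite cmulr0 cmul0r addr0 add0r; exact.
Qed.
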